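(* Let $G$ be a simple connected graph with $N_0$ vertices and $E_0\ge1$ edges, and let $n\ge1$. The number of spanning trees of the $n$-th hexagonal graph $H_n(G)$ is $$\tau(H_n(G))=5^{\left(\frac15\cdot6^{n-1}+\frac45\right)E_0-N_0+1}\cdot6^{N_0+\frac45(6^{n-1}-1)E_0-1}\cdot\tau(H_{n-1}(G)),$$ and the general expression is $$\tau(H_n(G))=5^{n\left(\frac45E_0-N_0+1\right)+\frac1{25}(6^n-1)E_0}\cdot6^{n\left(N_0-\frac45E_0-1\right)+\frac4{25}(6^n-1)E_0}\cdot\tau(G).$$
   Context: Graphs are finite, simple and connected. The hexagonal graph $H(G)$ of $G$ is obtained by replacing each edge $uv$ of $G$ by two internally disjoint $u$–$v$ paths, one of length $1$ (the edge $uv$ itself) and one of length $5$ (with 4 new internal vertices). Set $H_0(G)=G$ and $H_n(G)=H(H_{n-1}(G))$ for $n\ge1$. $\tau(F)$ denotes the number of spanning trees of a graph $F$. *)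

(* Defs.v *)
From mathcomp Require Import all_boot boolp.

Set Implicit Arguments.
Unset Strict Implicit.
Unset Printing Implicit Defensive.

Record sgraph := SGraph {
  vertex :> finType;
  adj : rel vertex;
  adj_sym : symmetric adj;
  adj_irrefl : irreflexive adj }.

Definition edges (G : sgraph) : {set {set G}} :=
  [set [set x; y] | x in G, y in G & adj x y].

Definition connected_rel (T : finType) (e : rel T) : Prop :=
  forall x y : T, connect e x y.

(* For symmetric e, every edge gives a closed walk of length 2; the graph
   cycles are exactly the duplicate-free closed walks of length at least 3. *)
Definition acyclic_rel (T : finType) (e : rel T) : Prop :=
  forall s : seq T, ucycle e s -> size s <= 2.

Definition connected_graph (G : sgraph) : Prop := connected_rel (@adj G).

(* A spanning subgraph of G is identified with its edge set S. *)
Definition spanning_tree (G : sgraph) (S : {set {set G}}) : Prop :=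
  [/\ S \subset edges G,
      connected_rel [rel x y : G | [set x; y] \in S] &
      acyclic_rel [rel x y : G | [set x; y] \in S]].

Definition tau (G : sgraph) : nat :=
  #|[set S : {set {set G}} | `[< spanning_tree S >]]|.

Section Hexagonal.
Variable G : sgraph.

Definition dart : finType := {d : G * G | adj d.1 d.2}.

(* The edge uv yields the two darts (u, v) and (v, u), and each dart d carries
   two new vertices, inr (d, false) and inr (d, true). The u-v path of length 5
   attached to uv is
     u, ((u, v), false), ((u, v), true), ((v, u), true), ((v, u), false), v. *)
Definition hex_vertex : finType := (G + dart * bool)%type.

Definition hex_adj (x y : hex_vertex) : bool :=
  match x, y with
  | inl u, inl v => adj u v
  | inl u, inr (d, b) => ((val d).1 == u) && ~~ b
  | inr (d, b), inl u => ((val d).1 == u) && ~~ b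
  | inr (d, b), inr (d', b') =>
      (d == d') && (b != b') ||
      [&& val d' == ((val d).2, (val d).1), b & b']
  end.

Lemma hex_adj_sym : symmetric hex_adj.
Proof.
move=> [u|[d b]] [v|[d' b']] //=; first exact: adj_sym.
rewrite eq_sym (eq_sym b) (andbC b); congr (_ || (_ && _)).
by case: (val d) (val d') => [u v] [u' v']; rewrite !xpair_eqE andbC
  (eq_sym u) (eq_sym v).
Qed.

Lemma hex_adj_irrefl : irreflexive hex_adj.
Proof.
move=> [u|[[[u v] uv] b]] /=; first exact: adj_irrefl.
rewrite !eqxx /= xpair_eqE; case: eqP => //= uv_eq.
by move: uv; rewrite /= uv_eq adj_irrefl.
Qed.

Definition hexagonal : sgraph := SGraph hex_adj_sym hex_adj_irrefl.

End Hexagonal.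

Definition hexagonal_iter (n : nat) (G : sgraph) : sgraph := iter n hexagonal G.

(* Main.v *)
Require Import Defs.
From mathcomp Require Import all_boot all_order all_algebra.
From mathcomp Require Import boolp reals exp.
From mathcomp Require Import zify lra.

(** The hexagonal graph [H(G)] replaces every edge [uv] of [G] by a hexagon, in
which [u] and [v] are adjacent and the other five edges form the detour from
[u] to [v].  A spanning tree [S] of [H(G)] meets each hexagon in one of two
ways.  Either [S] misses exactly one of the six edges, and then links [u] to [v]
inside the hexagon: there are 6 ways to do so.  Or [S] misses the direct edge
[uv] and exactly one of the five detour edges, and then does not link [u] to [v]
inside the hexagon: there are 5 ways.  The edges of [G] of the first kind form a
spanning tree of [G], and conversely every spanning tree [T] of [G] together
with an arbitrary choice of these local patterns gives a spanning tree of [H(G)].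
With N vertices and E edges in [G], a tree has N - 1 edges, so that
  tau(H(G)) = 5 ^ (E - N + 1) * 6 ^ (N - 1) * tau(G)
([tau_hexagonal]).  Since [H(G)] has 6 E edges and N + 4 E vertices, iterating
this identity gives both formulas, the exponents being geometric sums.

Cycles are only looked at once, to see that the spanning trees are the connected
edge sets with N - 1 edges ([spanning_treeP]); from there on everything is
connectedness and counting.  The main tool is [card_incident]: in a connected
graph, at least #|A| edges meet a proper vertex set A.  Applied to the four new
vertices of a hexagon it shows that S keeps at least four of the five detour
edges ([connected_detour]).  So a connected S has at least 4 edges in each
hexagon, and at least 5 in those of the first kind; as the first kind spans [G]
([linked_connected]), a total of N + 4 E - 1 edges forces equality everywhere
([tree_linked]).  The converse rests on [lift_connected]. *)

Set Implicit Arguments.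
Unset Strict Implicit.
Unset Printing Implicit Defensive.

(** * Spanning trees as connected edge sets of the right size *)

Lemma eq_set2 (V : finType) (a b c d : V) :
  ([set a; b] == [set c; d]) =
  (a == c) && (b == d) || (a == d) && (b == c).
Proof.
apply/eqP/idP => [E|]; last first.
  by case/orP=> /andP[/eqP-> /eqP->]; rewrite // setUC.
have := set21 a b; rewrite E !inE => /orP[]/eqP Ea; subst a; rewrite eqxx /=.
  have := set22 c b; rewrite E !inE => /orP[]/eqP Eb; subst b; last by rewrite eqxx.
  by have := set22 c d; rewrite -E !inE orbb => /eqP->; rewrite eqxx.
have := set22 d b; rewrite E !inE => /orP[]/eqP Eb; subst b; first by rewrite eqxx orbT.
by have := set21 c d; rewrite -E !inE orbb => /eqP->; rewrite eqxx.
Qed.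

Definition joins (V : finType) (S : {set {set V}}) : rel V :=
  [rel x y | [set x; y] \in S].

Lemma joins_sym (V : finType) (S : {set {set V}}) : symmetric (joins S).
Proof. by move=> x y; rewrite /joins /= setUC. Qed.

Lemma connect_joins_sym (V : finType) (S : {set {set V}}) :
  connect_sym (joins S).
Proof. by apply: sym_connect_sym; apply: joins_sym. Qed.

Lemma connect_homo (V W : finType) (e : rel V) (e' : rel W) (f : V -> W) :
  (forall x y, e x y -> connect e' (f x) (f y)) ->
  forall x y, connect e x y -> connect e' (f x) (f y).
Proof.
move=> ef x y /connectP[p]; elim: p x => [|z p IHp] x /=; first by move=> _ ->.
by case/andP=> /ef xz pz yz; apply: connect_trans xz (IHp _ pz yz).
Qed.

Lemma leaving_edge (V : finType) (S : {set {set V}}) (A : {set V}) (x r : V) :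
  connected_rel (joins S) -> x \in A -> r \notin A ->
  exists y z, [/\ y \in A, z \notin A & [set y; z] \in S].
Proof.
move=> conS; case/connectP: (conS x r) => p.
elim: p x => [|z p IHp] x /=; first by move=> _ -> ->.
case/andP=> xz pz rz xA rA; case zA: (z \in A); first exact: IHp pz rz zA rA.
by exists x, z; rewrite xA zA.
Qed.

(** Remove from [A] an endpoint [y] of an edge that leaves [A]: that edge meets
[A] but not [A :\ y].  The vertex [r] outside [A] is what guarantees such an
edge at every stage. *)
Lemma card_incident (V : finType) (S : {set {set V}}) (A : {set V}) (r : V) :
  connected_rel (joins S) -> r \notin A ->
  #|A| <= #|[set s in S | s :&: A != set0]|.
Proof.
move=> conS; have [n] := ubnP #|A|; elim: n A => // n IHn A leAn rA.
have [->|[x xA]] := set_0Vmem A; first by rewrite cards0.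
have [y [z [yA zA yz]]] := leaving_edge conS xA rA.
have rA' : r \notin A :\ y by rewrite !inE (negPf rA) andbF.
have /IHn/(_ rA') : #|A :\ y| < n by move: leAn; rewrite (cardsD1 y A) yA.
rewrite (cardsD1 y A) yA add1n => le1; apply: leq_ltn_trans le1 _.
apply/proper_card/properP; split.
  apply/subsetP=> s; rewrite !inE => /andP[-> /set0Pn[w]]; rewrite !inE.
  by case/and3P=> ws _ wA; apply/set0Pn; exists w; rewrite !inE ws.
exists [set y; z]; rewrite inE yz.
  by apply/set0Pn; exists y; rewrite !inE eqxx.
rewrite negbK; apply/eqP/setP=> w; rewrite !inE.
have [->|] := eqVneq w y; first by rewrite andbF.
by have [->|] := eqVneq w z; rewrite //= (negPf zA).
Qed.

Lemma connected_card (V : finType) (S : {set {set V}}) :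
  connected_rel (joins S) -> #|V| <= #|S|.+1.
Proof.
move=> conS; have [r _|V0] := pickP (@predT V); last by rewrite (eq_card0 V0).
have rA : r \notin [set~ r] by rewrite !inE eqxx.
have := card_incident conS rA; rewrite cardsC1.
have := subset_leq_card (subsetIl S [set s : {set V} | s :&: [set~ r] != set0]).
by rewrite -setIdE; case: #|V| => //= n H1 H2; apply: leq_trans H2 H1.
Qed.

Lemma next_next (V : finType) (s : seq V) (x : V) :
  uniq s -> 2 < size s -> x \in s -> next s (next s x) != x.
Proof.
move=> us ss /rot_to[i s' Es]; rewrite -!(next_rot i us) Es.
have : uniq (x :: s') by rewrite -Es rot_uniq.
have : 2 < size (x :: s') by rewrite -Es size_rot.
case: s' {Es} => [|y [|z t]] //= _; rewrite !inE !negb_or eqxx.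
by case/andP=> /and3P[xy xz _] _; rewrite eqxx (eq_sym y) (negPf xy) eq_sym.
Qed.

(** The cycle [s] has as many edges as vertices, and none of them meets the
vertices outside [s], which bring one further edge each by [card_incident]. *)
Lemma connected_cycle_card (V : finType) (S : {set {set V}}) (s : seq V) :
  connected_rel (joins S) -> ucycle (joins S) s -> 2 < size s -> #|V| <= #|S|.
Proof.
move=> conS /andP[cs us] ss.
have [x xs] : exists x, x \in s by case: s ss {cs us} => // x s; exists x; rewrite mem_head.
pose A := [set y | y \notin s].
have xA : x \notin A by rewrite inE xs.
pose f y := [set y; next s y].
have injf : {in s &, injective f}.
  move=> y z ys zs /eqP; rewrite eq_set2 => /orP[/andP[/eqP]//|/andP[/eqP Ey /eqP Ez]].
  by have := next_next us ss ys; rewrite Ez -Ey eqxx.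
pose B := f @: [set y in s].
have cB : #|B| = #|[set y in s]|.
  by apply: card_in_imset => y z; rewrite !inE; apply: injf.
have cV : #|A| + #|[set y in s]| = #|V|.
  have -> : A = ~: [set y in s] by apply/setP=> y; rewrite !inE.
  by rewrite addnC cardsC.
rewrite -cV -cB; apply: leq_trans (leq_add (card_incident conS xA) (leqnn _)) _.
rewrite -cardsUI -[X in _ <= X]addn0; apply: leq_add.
  apply/subset_leq_card/subsetP=> t; rewrite !inE => /orP[/andP[]//|/imsetP[y]].
  by rewrite inE => ys ->; apply: next_cycle cs ys.
rewrite leqn0 cards_eq0; apply/eqP/setP=> t; rewrite !inE.
apply/negP=> /andP[/andP[_ /set0Pn[w wtA]] /imsetP[y]]; rewrite inE => ys Et.
by move: wtA; rewrite Et !inE => /andP[/orP[]/eqP->]; rewrite ?mem_next ys.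
Qed.

Definition within (V : finType) (S : {set {set V}}) (A : {set V}) :=
  [set s in S | s \subset A].

(** A subtree of a connected acyclic graph grows one vertex at a time: an edge
[yz] leaves [A], and a second edge from [A] to [z] would close a cycle through
[z], since [A] is connected by the edges within it.  For [k = #|V| - 1] this
bounds the number of all edges. *)
Lemma acyclic_grow (V : finType) (S : {set {set V}}) :
  connected_rel (joins S) -> acyclic_rel (joins S) ->
  (forall s, s \in S -> exists x y, s = [set x; y] /\ x != y) ->
  forall k, k < #|V| -> exists A : {set V},
    [/\ #|A| = k.+1, #|within S A| <= k &
        {in A &, forall x y, connect (joins (within S A)) x y}].
Proof.
move=> conS acyS S2; elim=> [|k IHk] kV.
  have /card_gt0P[r _] := kV; exists [set r]; rewrite cards1; split=> //.
    rewrite leqn0 cards_eq0; apply/eqP/setP=> s; rewrite !inE.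
    apply/negP=> /andP[/S2[x [y [-> xy]]]]; rewrite subUset !sub1set !inE.
    by case/andP=> /eqP xr /eqP yr; rewrite xr yr eqxx in xy.
  by move=> x y; rewrite !inE => /eqP-> /eqP->.
have [A [cA cSA conA]] := IHk (ltnW kV).
have [x xA] : exists x, x \in A by apply/card_gt0P; rewrite cA.
have [r rA] : exists r, r \notin A.
  have : 0 < #|~: A| by rewrite -(ltn_add2l #|A|) cardsC addn0 cA.
  by case/card_gt0P=> r; rewrite inE; exists r.
have [y [z [yA zA yz]]] := leaving_edge conS xA rA.
(* Two edges from A to z would give a cycle z, y, ..., w. *)
have uniq_edge w : w \in A -> [set w; z] \in S -> w = y.
  move=> wA wz; have [//|wy] := eqVneq w y; exfalso.
  have /connectP[p0 pp0] := conA y w yA wA; case/shortenP: pp0 => p pp up _ wp.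
  have pA : {subset y :: p <= A}.
    move=> v; rewrite inE => /orP[/eqP->//|].
    elim: (p) (y) pp => [|u q IHq] t //= /andP[tu qu].
    rewrite inE => /orP[/eqP->|]; last exact: IHq qu.
    by move: tu; rewrite /joins /= inE subUset !sub1set; case/and3P.
  have cyc : ucycle (joins S) (z :: y :: p).
    have pS : path (joins S) y p.
      by apply: sub_path pp => a b; rewrite /joins /= inE => /andP[].
    rewrite /ucycle [cycle _ _]/= joins_sym [joins _ _ _]yz rcons_path pS -wp.
    by rewrite [joins _ _ _]wz cons_uniq up !andbT; apply: (contra (pA z)) zA.
  have := acyS _ cyc; case: p wp {pp pA up cyc} => [wp|//].
  by rewrite wp eqxx in wy.
exists (z |: A); split.
- by rewrite cardsU1 zA cA.
- apply: leq_trans (_ : #|[set y; z] |: within S A| <= _); last first.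
    by rewrite cardsU1; case: (_ \in _) => /=; rewrite ?add0n ?add1n // ltnW.
  apply/subset_leq_card/subsetP=> s; rewrite !inE => /andP[sS].
  have [a [b [Es ab]]] := S2 _ sS; rewrite sS Es !subUset !sub1set !inE.
  rewrite Es in sS; case/andP=> /orP[/eqP Ea|aA] /orP[/eqP Eb|bA].
  + by rewrite Ea Eb eqxx in ab.
  + rewrite (uniq_edge b bA) ?Ea 1?setUC ?eqxx //; by rewrite -Ea.
  + by rewrite (uniq_edge a aA) ?Eb ?eqxx //; rewrite -Eb.
  + by rewrite aA bA orbT.
have sub : subrel (joins (within S A)) (joins (within S (z |: A))).
  move=> a b; rewrite /joins /= !inE => /andP[-> /=] /subset_trans; apply.
  exact: subsetUr.
have csub a b : a \in A -> b \in A -> connect (joins (within S (z |: A))) a b.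
  by move=> aA bA; apply: (connect_homo (f := id)) (conA _ _ aA bA) => u v /sub/connect1.
have czy : connect (joins (within S (z |: A))) z y.
  by apply: connect1; rewrite /joins /= !inE setUC yz subUset !sub1set !inE eqxx yA orbT.
move=> a b; rewrite !inE => /orP[/eqP->|aA] /orP[/eqP->|bA] //.
- exact: connect_trans czy (csub _ _ yA bA).
- by rewrite connect_joins_sym; exact: connect_trans czy (csub _ _ yA aA).
exact: csub.
Qed.

Lemma edgesP (G : sgraph) (s : {set G}) :
  reflect (exists x y : G, adj x y /\ s = [set x; y]) (s \in edges G).
Proof.
apply: (iffP imset2P) => [[x y _]|[x [y [xy ->]]]]; last first.
  by exists x y; rewrite ?inE.
by rewrite !inE /= => xy ->; exists x, y.
Qed.

Lemma edges_set2 (G : sgraph) (x y : G) : ([set x; y] \in edges G) = adj x y.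
Proof.
apply/edgesP/idP => [[a [b [ab /eqP]]]|]; last by exists x, y.
by rewrite eq_set2 => /orP[]/andP[/eqP-> /eqP->] //; rewrite adj_sym.
Qed.

Lemma adj_neq (G : sgraph) (x y : G) : adj x y -> x != y.
Proof. by move=> xy; apply/eqP=> E; rewrite E adj_irrefl in xy. Qed.

(** Acyclicity as a cardinality: both directions compare the number of edges with
the lower bound for connected graphs. *)
Lemma spanning_treeP (G : sgraph) (S : {set {set G}}) :
  0 < #|G| ->
  spanning_tree S <->
  [/\ S \subset edges G, connected_rel (joins S) & #|S|.+1 = #|G|].
Proof.
move=> G0; split=> [[sS conS acyS]|[sS conS cS]]; split=> //.
  apply/eqP; rewrite eqn_leq connected_card // andbT.
  have S2 s : s \in S -> exists x y, s = [set x; y] /\ x != y.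
    by move/(subsetP sS)/edgesP => [x [y [/adj_neq xy ->]]]; exists x, y.
  have [|A [cA cS _]] := acyclic_grow conS acyS S2 (k := #|G|.-1).
    by rewrite prednK.
  rewrite prednK // in cA; rewrite -(prednK G0) ltnS.
  have AT : A = [set: G] by apply/eqP; rewrite eqEcard subsetT cardsT cA /=.
  apply: leq_trans cS; apply/subset_leq_card/subsetP=> s sS'.
  by rewrite inE sS' AT subsetT.
move=> s cyc; rewrite leqNgt; apply/negP=> ss.
by have := connected_cycle_card conS cyc ss; rewrite -cS ltnn.
Qed.

(** * Counting sets by their traces on the fibers of a map *)

(** A set is determined by its traces on the fibers of [h], and these can be
prescribed independently. *)
Lemma card_fiberwise (X Y : finType) (h : X -> Y) (F : Y -> {set {set X}}) :
  (forall y A, A \in F y -> A \subset h @^-1: [set y]) ->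
  #|[set S : {set X} | [forall y, (S :&: h @^-1: [set y]) \in F y]]| =
  \prod_y #|F y|.
Proof.
move=> FP; transitivity #|family (fun y => mem (F y))|; last first.
  by rewrite card_family foldrE big_image.
pose g (S : {set X}) := [ffun y => S :&: h @^-1: [set y]].
have gE (S : {set X}) x : (x \in S) = (x \in g S (h x)) by rewrite ffunE !inE eqxx andbT.
have injg : injective g by move=> S1 S2 E; apply/setP=> x; rewrite (gE S1) (gE S2) E.
rewrite -(card_imset _ injg); apply: eq_card => f.
apply/imsetP/familyP => [[S]|fF].
  by rewrite inE => /forallP SF -> y; rewrite ffunE.
pose S := [set x | x \in f (h x)].
have SE y : S :&: h @^-1: [set y] = f y.
  apply/setP=> x; rewrite !inE; apply/andP/idP => [[xf /eqP <-]//|xf].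
  by have := subsetP (FP _ _ (fF y)) x xf; rewrite !inE => /eqP->.
exists S; last by apply/ffunP=> y; rewrite ffunE SE.
by rewrite inE; apply/forallP=> y; rewrite SE; apply: fF.
Qed.

Lemma card_fibers (X Y : finType) (h : X -> Y) (S : {set X}) :
  #|S| = \sum_y #|S :&: h @^-1: [set y]|.
Proof.
rewrite -sum1_card (partition_big h predT) //=; apply: eq_bigr => y _.
by rewrite -sum1_card; apply: eq_bigl => x; rewrite !inE.
Qed.

(** * The hexagons *)

Section Gadgets.
Variable G : sgraph.
Notation H := (hexagonal G).
Implicit Types (d : dart G) (S : {set {set H}}) (T : {set {set G}}) (e : {set G}).

Definition dart_edge d : {set G} := [set (val d).1; (val d).2].

Lemma flip_proof d : adj (val d).2 (val d).1.
Proof. by rewrite adj_sym (valP d). Qed.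

Definition flip d : dart G := Sub ((val d).2, (val d).1) (flip_proof d).

Lemma flipK : involutive flip.
Proof. by move=> d; apply: val_inj; rewrite /=; case: (val d). Qed.

Lemma dart_neq d : (val d).1 != (val d).2.
Proof. exact: adj_neq (valP d). Qed.

Lemma flip_neq d : (flip d == d) = false.
Proof.
apply/eqP=> /(congr1 val)/(congr1 fst) /= E.
by have := dart_neq d; rewrite E eqxx.
Qed.

Lemma dart_edge_flip d : dart_edge (flip d) = dart_edge d.
Proof. by rewrite /dart_edge setUC. Qed.

Lemma dart_edge_eq d d' : (dart_edge d' == dart_edge d) = (d' == d) || (d' == flip d).
Proof.
rewrite /dart_edge eq_set2 -!(inj_eq val_inj) /=.
by case: (val d') (val d) => [a b] [a' b']; rewrite !xpair_eqE.
Qed.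

Lemma dart_edgeP e : reflect (exists d, e = dart_edge d) (e \in edges G).
Proof.
apply: (iffP (edgesP e)) => [[x [y [xy ->]]]|[d ->]]; last first.
  by exists (val d).1, (val d).2; split=> //; apply: (valP d).
by exists (exist _ (x, y) xy).
Qed.

Definition inner d b : H := inr (d, b).
Definition outer (u : G) : H := inl u.

Definition direct d : {set H} := [set outer (val d).1; outer (val d).2].
Definition foot d : {set H} := [set outer (val d).1; inner d false].
Definition leg d : {set H} := [set inner d false; inner d true].
Definition mid d : {set H} := [set inner d true; inner (flip d) true].

(** The five edges of the long path, from the tail of [d] to its head; the half
next to the head is the one carried by [flip d]. *)
Definition detour d : seq {set H} :=
  [:: foot d; leg d; mid d; leg (flip d); foot (flip d)].
Definition gadget d := direct d :: detour d.

Lemma direct_flip d : direct (flip d) = direct d.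
Proof. by rewrite /direct setUC. Qed.
Lemma mid_flip d : mid (flip d) = mid d.
Proof. by rewrite /mid flipK setUC. Qed.

Lemma outer_eq u v : (outer u == outer v) = (u == v).
Proof. by []. Qed.
Lemma inner_eq d b d' b' : (inner d b == inner d' b') = (d == d') && (b == b').
Proof. by []. Qed.

Lemma gadget_uniq d : uniq (gadget d).
Proof.
have dd' := flip_neq d; have d'd : (d == flip d) = false by rewrite eq_sym.
rewrite /= !inE !negb_or !eq_set2.
by rewrite !(outer_eq, inner_eq, dd', d'd, eqxx) ?andbF ?andbT ?orbF.
Qed.

(** Chosen so that the union of the two values at the ends of an edge of [H] is
the edge of [G] whose hexagon contains it: among the edges of [H], the hexagons
are then the fibers of [origin]. *)
Definition locus (x : H) : {set G} :=
  match x with inl u => [set u] | inr (d, _) => dart_edge d end.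
Definition origin (f : {set H}) : {set G} := \bigcup_(x in f) locus x.

Lemma origin2 x y : origin [set x; y] = locus x :|: locus y.
Proof.
rewrite /origin; have [->|xy] := eqVneq x y; first by rewrite setUid big_set1 setUid.
by rewrite big_setU1 ?inE //= big_set1.
Qed.

Lemma origin_gadget d f : f \in gadget d -> origin f = dart_edge d.
Proof.
have foot_origin d0 : origin (foot d0) = dart_edge d0.
  by rewrite origin2 /= /dart_edge setUA setUid.
have leg_origin d0 : origin (leg d0) = dart_edge d0 by rewrite origin2 /= setUid.
rewrite !inE => /or4P[/eqP->|/eqP->|/eqP->|/or3P[]/eqP->] //.
- by rewrite origin2.
- by rewrite origin2 /= dart_edge_flip setUid.
- by rewrite leg_origin dart_edge_flip.
- by rewrite foot_origin dart_edge_flip.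
Qed.

Lemma gadget_edges d f : f \in gadget d -> f \in edges H.
Proof.
have dart_adj d0 : adj (val d0).1 (val d0).2 by apply: (valP d0).
rewrite !inE => /or4P[/eqP->|/eqP->|/eqP->|/or3P[]/eqP->]; rewrite edges_set2 /adj /=.
all: by rewrite ?eqxx ?andbT ?orbT ?dart_adj.
Qed.

Lemma gadget_flip d : gadget (flip d) =i gadget d.
Proof.
move=> f; rewrite !inE direct_flip mid_flip flipK.
by case: (f == foot d); case: (f == leg d); case: (f == mid d);
  case: (f == leg (flip d)); rewrite ?orbT ?orbF.
Qed.

Lemma edges_gadget f : f \in edges H -> exists d, f \in gadget d.
Proof.
move/edgesP=> [[u|[d b]] [[v|[d' b']] [/=]]].
- move=> uv ->; exists (exist _ (u, v) uv).
  by rewrite !inE eqxx.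
- case/andP=> /eqP<- /negPf-> ->; exists d'.
  by rewrite !inE eqxx ?orbT.
- case/andP=> /eqP<- /negPf-> ->; exists d.
  by rewrite setUC !inE eqxx ?orbT.
case/orP=> [/andP[/eqP<- bb'] ->|/and3P[/eqP E b1 b1'] ->]; exists d.
  by case: b b' bb' => [] [] //= _; rewrite ?[[set inr (d, true); _]]setUC !inE eqxx ?orbT.
have -> : d' = flip d by apply: val_inj.
by rewrite b1 b1' !inE eqxx ?orbT.
Qed.

Lemma edges_originE d f :
  (f \in edges H) && (origin f == dart_edge d) = (f \in gadget d).
Proof.
apply/andP/idP => [[/edges_gadget[d' fd']]|fd]; last first.
  by rewrite (gadget_edges fd) (origin_gadget fd).
rewrite (origin_gadget fd') dart_edge_eq => /orP[]/eqP E; subst d' => //.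
by rewrite -gadget_flip.
Qed.

Lemma origin_edges f : f \in edges H -> origin f \in edges G.
Proof. by case/edges_gadget=> d /origin_gadget->; apply/dart_edgeP; exists d. Qed.

Definition fiber S e := S :&: origin @^-1: [set e].

Lemma in_fiber S d f : S \subset edges H ->
  (f \in fiber S (dart_edge d)) = (f \in S) && (f \in gadget d).
Proof.
move=> sS; rewrite in_setI -edges_originE [f \in _ @^-1: _]inE in_set1.
by case fS: (f \in S) => //=; rewrite (subsetP sS).
Qed.

Lemma card_count (X : finType) (A : {set X}) (s : seq X) :
  uniq s -> (forall x, x \in A -> x \in s) -> #|A| = count (mem A) s.
Proof.
move=> us As; rewrite -size_filter -(card_uniqP (filter_uniq _ us)).
by apply: eq_card => x; rewrite mem_filter inE /= andb_idr //; apply: As.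
Qed.

Lemma card_fiber S d : S \subset edges H ->
  #|fiber S (dart_edge d)| = count (mem S) (gadget d).
Proof.
move=> sS; rewrite (@card_count _ _ (gadget d)) ?gadget_uniq //.
  by apply: eq_in_count => f fd /=; rewrite in_fiber // fd andbT.
by move=> f; rewrite in_fiber // => /andP[].
Qed.

Lemma fiber_nonedge S e : S \subset edges H -> e \notin edges G -> fiber S e = set0.
Proof.
move=> sS eG; apply/setP=> f; rewrite !inE; apply/negP=> /andP[/(subsetP sS)].
by move/origin_edges=> + /eqP E; rewrite E (negPf eG).
Qed.

Lemma card_split S : S \subset edges H ->
  #|S| = \sum_(e in edges G) #|fiber S e|.
Proof.
move=> sS; rewrite (card_fibers origin) (bigID (mem (edges G))) /=.
by rewrite [X in _ + X]big1 ?addn0 // => e eG; rewrite [_ :&: _](fiber_nonedge sS eG) cards0.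
Qed.

Lemma card_hexagonal_edges : #|edges H| = 6 * #|edges G|.
Proof.
rewrite card_split // mulnC -sum_nat_const; apply: eq_bigr => e /dart_edgeP[d ->].
rewrite card_fiber //; apply/eqP; rewrite -all_count; apply/allP=> f; exact: gadget_edges.
Qed.

Lemma card_dart : #|dart G| = 2 * #|edges G|.
Proof.
rewrite -cardsT (card_fibers dart_edge) (bigID (mem (edges G))) /=.
rewrite [X in _ + X]big1 ?addn0 => [|e eG].
  rewrite mulnC -sum_nat_const; apply: eq_bigr => e /dart_edgeP[d ->].
  rewrite (_ : _ :&: _ = [set d; flip d]) ?cards2 1?eq_sym ?flip_neq //.
  by apply/setP=> d'; rewrite !inE dart_edge_eq.
apply/eqP; rewrite cards_eq0; apply/eqP/setP=> d; rewrite !inE.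
by apply: contraNF eG => /eqP<-; apply/dart_edgeP; exists d.
Qed.

Lemma card_hexagonal : #|H| = #|G| + 4 * #|edges G|.
Proof. by rewrite card_sum card_prod card_bool card_dart mulnAC. Qed.

(** * Spanning trees of the hexagonal graph *)

(** The edges that meet the four new vertices of a hexagon are the edges of its
detour, and a connected set has at least four of them. *)
Lemma connected_detour S d : S \subset edges H -> connected_rel (joins S) ->
  4 <= count (mem S) (detour d).
Proof.
move=> sS conS.
pose s := [:: inner d false; inner d true; inner (flip d) false; inner (flip d) true].
have us : uniq s.
  by rewrite /= !inE !inner_eq !(flip_neq, eq_sym d, eqxx) ?andbF.
pose A : {set H} := [set x in s].
have rA : outer (val d).1 \notin A by rewrite !inE.
have cA : #|A| = 4 by rewrite cardsE (card_uniqP us).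
rewrite -cA; apply: leq_trans (card_incident conS rA) _.
have ud : uniq (detour d) by have := gadget_uniq d; rewrite cons_uniq => /andP[].
rewrite (@card_count _ _ (detour d)) //.
  by apply: sub_count => f /=; rewrite inE => /andP[].
move=> f; rewrite inE => /andP[fS /set0Pn[x]]; rewrite inE => /andP[xf].
rewrite inE => xs; have [d' fd'] := edges_gadget (subsetP sS _ fS).
have sup : locus x = dart_edge d.
  by move: xs; rewrite !inE => /or4P[]/eqP->; rewrite /= ?dart_edge_flip.
have Ed : dart_edge d' = dart_edge d.
  apply/esym/eqP; rewrite eqEcard !cards2 !dart_neq leqnn andbT.
  by rewrite -(origin_gadget fd') -sup; apply: bigcup_sup xf.
have : f \in gadget d by rewrite -edges_originE (subsetP sS _ fS) (origin_gadget fd') Ed /=.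
rewrite in_cons => /orP[/eqP Ef|//].
by move: xs xf; rewrite Ef !inE => /or4P[]/eqP->.
Qed.

Lemma count_gadget S d :
  count (mem S) (gadget d) = (direct d \in S) + count (mem S) (detour d).
Proof. by []. Qed.

(** The edges of [G] whose ends are joined by [S] inside their hexagon: for a
connected [S] at most one detour edge is missing, and then this means having at
least five of the six edges. *)
Definition linked_edges S : {set {set G}} := [set e in edges G | 5 <= #|fiber S e|].

Lemma linked_sub S : linked_edges S \subset edges G.
Proof. by apply/subsetP=> e; rewrite inE => /andP[]. Qed.

Lemma linked_dart S d : S \subset edges H ->
  (dart_edge d \in linked_edges S) = (5 <= count (mem S) (gadget d)).
Proof.
move=> sS; rewrite inE card_fiber // andb_idl // => _.
by apply/dart_edgeP; exists d.
Qed.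

(** A retraction onto the vertices of [G]: a new vertex goes to the nearer end of
its hexagon if the detour is intact that far, and else to the other end. *)
Definition anchor S (x : H) : G :=
  match x with
  | inl u => u
  | inr (d, b) =>
      if (foot d \in S) && (b ==> (leg d \in S)) then (val d).1 else (val d).2
  end.

(** [anchor] maps every edge of [S] either to a single vertex or into the ends of
a linked edge.  Only a hexagon that is not linked needs care: there the direct
edge is missing and exactly one detour edge is, so the new vertices on each
side of the gap are sent to the end of their side. *)
Lemma linked_connected S : S \subset edges H -> connected_rel (joins S) ->
  connected_rel (joins (linked_edges S)).
Proof.
move=> sS conS u v.
apply: (connect_homo (f := anchor S) _ (conS (outer u) (outer v))) => x y xy.
have [d] := edges_gadget (subsetP sS _ xy).
pose u0 := (val d).1; pose v0 := (val d).2.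
have end_d z : z \in [set x; y] -> [set x; y] \in gadget d -> anchor S z \in [set u0; v0].
  move=> zxy /origin_gadget Eo.
  have : locus z \subset dart_edge d by rewrite -Eo; apply: bigcup_sup zxy.
  case: z {zxy} => [w|[d' b]] /=; first by rewrite sub1set.
  by move/subsetP; apply; rewrite /dart_edge; case: ifP; rewrite !inE eqxx ?orbT.
move=> fd; have := connected_detour d sS conS.
have [dT _|] := boolP (dart_edge d \in linked_edges S).
  have cuv : connect (joins (linked_edges S)) u0 v0 by apply: connect1.
  have cvu : connect (joins (linked_edges S)) v0 u0 by rewrite connect_joins_sym.
  have := end_d x (set21 _ _) fd; have := end_d y (set22 _ _) fd.
  by rewrite !in_set2 => /orP[]/eqP-> /orP[]/eqP->.
rewrite linked_dart // -ltnNge ltnS => le4 ge4.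
suff -> : anchor S x = anchor S y by [].
have same p q : anchor S p = anchor S q -> [set x; y] == [set p; q] ->
    anchor S x = anchor S y.
  by move=> Epq; rewrite eq_set2 => /orP[]/andP[/eqP-> /eqP->].
have xyS : [set x; y] \in S by [].
have {fd} := fd; rewrite !in_cons in_nil orbF.
case/or4P=> [E|E|E|/or3P[]E]; move: le4 ge4 xyS; rewrite {1}(eqP E) /=.
- by move=> + ge4 dS; rewrite dS add1n ltnNge ge4.
- by move=> _ _ fS; apply: same E; rewrite /= fS.
- by move=> _ _ lS; apply: same E; rewrite /= lS.
(* The middle edge is present, so exactly one of the two sides has a gap. *)
- move=> le4 ge4 mS; apply: same E; move: le4 ge4; rewrite /= mS.
  by do 4 case: (_ \in S); case: (_ \in S).
- by move=> _ _ lS; apply: same E; rewrite /= lS.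
- by move=> _ _ fS; apply: same E; rewrite /= fS.
Qed.

(** With at most one detour edge missing every new vertex is joined to an end of
its hexagon, and with at least five edges of a hexagon its ends are joined. *)
Lemma lift_connected S T : T \subset edges G -> connected_rel (joins T) ->
  (forall d, 4 <= count (mem S) (detour d)) ->
  (forall d, dart_edge d \in T -> 5 <= count (mem S) (gadget d)) ->
  connected_rel (joins S).
Proof.
move=> sT conT det4 gad5.
have cfoot d : foot d \in S -> connect (joins S) (outer (val d).1) (inner d false).
  by move=> ?; apply: connect1.
have cleg d : leg d \in S -> connect (joins S) (inner d false) (inner d true).
  by move=> ?; apply: connect1.
have cmid d : mid d \in S -> connect (joins S) (inner d true) (inner (flip d) true).
  by move=> ?; apply: connect1.
have cS := connect_joins_sym S.
have ends d : dart_edge d \in T ->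
    connect (joins S) (outer (val d).1) (outer (val d).2).
  move=> /gad5; rewrite /=; case dS: (direct d \in S).
    by move=> _; apply: connect1.
  case f1: (foot d \in S); case l1: (leg d \in S); case m: (mid d \in S);
  case l2: (leg (flip d) \in S); case f2: (foot (flip d) \in S) => // _.
  apply: connect_trans (cfoot _ f1) (connect_trans (cleg _ l1) (connect_trans (cmid _ m) _)).
  by rewrite cS; apply: connect_trans (cfoot _ f2) (cleg _ l2).
have outs u v : connect (joins S) (outer u) (outer v).
  apply: (connect_homo (f := outer) _ (conT u v)) => x y xy.
  have axy : adj x y by rewrite -edges_set2 (subsetP sT).
  by have := ends (exist _ (x, y) axy) xy.
have ins d b : exists u, connect (joins S) (outer u) (inner d b).
  have := det4 d; rewrite /=.
  case f1: (foot d \in S).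
    case l1: (leg d \in S).
      by exists (val d).1; case: b; rewrite ?(connect_trans (cfoot _ f1) (cleg _ l1)) ?cfoot.
    case: b; last by exists (val d).1; apply: cfoot.
    case m: (mid d \in S);
      case l2: (leg (flip d) \in S); case f2: (foot (flip d) \in S) => // _.
    exists (val d).2; apply: connect_trans (connect_trans (cfoot _ f2) (cleg _ l2)) _.
    by rewrite cS cmid.
  case l1: (leg d \in S); case m: (mid d \in S);
  case l2: (leg (flip d) \in S); case f2: (foot (flip d) \in S) => // _.
  exists (val d).2; apply: connect_trans (connect_trans (cfoot _ f2) (cleg _ l2)) _.
  by rewrite cS; case: b; [|apply: connect_trans (cleg _ l1) _]; apply: cmid.
have base x : exists u, connect (joins S) (outer u) x.
  by case: x => [u|[d b]]; [exists u|apply: ins].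
move=> x y; have [u ux] := base x; have [v vy] := base y.
by apply: connect_trans (connect_trans _ (outs u v)) vy; rewrite cS.
Qed.

(** The possible traces on the hexagon of [e] of a spanning tree whose linked
edges form [T]; the image of [e] under [outer] is its direct edge. *)
Definition tree_traces T e : {set {set {set H}}} :=
  if e \in T then [set A : {set {set H}} | A \subset fiber (edges H) e & #|A| == 5]
  else if e \in edges G then
    [set A : {set {set H}} |
      A \subset fiber (edges H) e :\ (outer @: e) & #|A| == 4]
  else [set set0].

Lemma direct_imset d : outer @: dart_edge d = direct d.
Proof. by rewrite /dart_edge imsetU1 imset_set1. Qed.

Lemma card_gadget_fiber d : #|fiber (edges H) (dart_edge d)| = 6.
Proof.
rewrite card_fiber //; apply/eqP; rewrite -all_count; apply/allP=> f.
exact: gadget_edges.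
Qed.

Lemma direct_fiber d : direct d \in fiber (edges H) (dart_edge d).
Proof. by rewrite in_fiber // (@gadget_edges d) ?mem_head. Qed.

Lemma card_tree_traces T : T \subset edges G ->
  \prod_e #|tree_traces T e| = 6 ^ #|T| * 5 ^ (#|edges G| - #|T|).
Proof.
move=> sT; rewrite (bigID (mem T)) /= -prod_nat_const; congr (_ * _).
  apply: eq_bigr => e eT; have /dart_edgeP[d Ed] := subsetP sT _ eT.
  by rewrite /tree_traces eT cards_draws Ed card_gadget_fiber.
have -> : #|edges G| - #|T| = #|edges G :\: T|.
  by rewrite cardsD (setIidPr sT).
rewrite -prod_nat_const (bigID (mem (edges G))) /= [X in _ * X]big1 ?muln1; last first.
  by move=> e /andP[eT eG]; rewrite /tree_traces (negPf eT) (negPf eG) cards1.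
apply: eq_big => [e|e /andP[eT eG]]; first by rewrite inE.
have /dart_edgeP[d Ed] := eG; rewrite /tree_traces (negPf eT) eG cards_draws Ed direct_imset.
have := cardsD1 (direct d) (fiber (edges H) (dart_edge d)).
by rewrite direct_fiber card_gadget_fiber add1n => -[<-].
Qed.

Lemma card_hexagonal_gt0 : 0 < #|G| -> 0 < #|H|.
Proof. by rewrite card_hexagonal => G0; rewrite addn_gt0 G0. Qed.

Lemma fiber_ge S d : S \subset edges H -> connected_rel (joins S) ->
  4 + (dart_edge d \in linked_edges S) <= #|fiber S (dart_edge d)|.
Proof.
move=> sS conS; have := connected_detour d sS conS.
rewrite linked_dart // card_fiber // count_gadget.
set c := count _ (detour d) => c4; case: (leqP 5 _) => //= _.
by rewrite (leq_trans c4) ?leq_addl.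
Qed.

Lemma sum_tree_fibers T : T \subset edges G ->
  \sum_(e in edges G) (4 + (e \in T)) = 4 * #|edges G| + #|T|.
Proof.
move=> sT; rewrite big_split /= sum_nat_const mulnC; congr (_ + _).
rewrite -sum1_card big_mkcond [RHS]big_mkcond /=; apply: eq_bigr => e _.
by have := subsetP sT e; case: (e \in T) => [->|_] //; case: ifP.
Qed.

(** If [G] has N vertices and E edges, the hexagons contain at least
4 E + #|linked_edges S| edges of [S], which has N + 4 E - 1 of them, and the
linked edges are at least N - 1 in number because they connect [G].  Hence all
these bounds are attained. *)
Lemma tree_linked S : 0 < #|G| -> spanning_tree S ->
  spanning_tree (linked_edges S) /\
  forall e, e \in edges G -> #|fiber S e| = 4 + (e \in linked_edges S).
Proof.
move=> G0 /(spanning_treeP _ (card_hexagonal_gt0 G0))[sS conS cS].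
have conC := linked_connected sS conS.
have geC : forall e, e \in edges G -> 4 + (e \in linked_edges S) <= #|fiber S e|.
  by move=> e /dart_edgeP[d ->]; apply: fiber_ge.
have sumC := sum_tree_fibers (linked_sub S).
have lecard := connected_card conC.
have lesum : \sum_(e in edges G) (4 + (e \in linked_edges S)) <=
    \sum_(e in edges G) #|fiber S e|.
  by apply: leq_sum.
have Ecard : #|linked_edges S|.+1 = #|G|.
  move: lesum; rewrite sumC -card_split //; move: cS; rewrite card_hexagonal; lia.
split; first by apply/spanning_treeP => //; split=> //; apply: linked_sub.
have /eqP : \sum_(e in edges G) (4 + (e \in linked_edges S)) =
    \sum_(e in edges G) #|fiber S e|.
  rewrite sumC -card_split //; move: cS; rewrite card_hexagonal; lia.
rewrite (leqif_sum (fun e eG => leqif_eq (geC e eG))) => /forallP allE e eG.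
by have := allE e; rewrite eG => /eqP->.
Qed.

Lemma tree_tracesP T S : 0 < #|G| -> spanning_tree T ->
  (spanning_tree S /\ linked_edges S = T) <-> forall e, fiber S e \in tree_traces T e.
Proof.
move=> G0 treeT; have [sT conT cT] := (spanning_treeP T G0).1 treeT.
split=> [[treeS ET] e|allS].
  have [sS conS cS] := (spanning_treeP S (card_hexagonal_gt0 G0)).1 treeS.
  have [_ cE] := tree_linked G0 treeS; rewrite ET in cE.
  have sF : fiber S e \subset fiber (edges H) e by apply: setSI.
  rewrite /tree_traces; case: ifPn => eT.
    by rewrite inE sF cE ?eT // (subsetP sT).
  case: ifPn => eG; last by rewrite inE fiber_nonedge.
  rewrite inE subsetD1 sF cE // (negPf eT) addn0 eqxx andbT /=.
  have /dart_edgeP[d Ed] := eG; rewrite Ed direct_imset in_fiber // negb_and.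
  have := connected_detour d sS conS; have := cE _ eG.
  rewrite (negPf eT) Ed card_fiber // count_gadget.
  by set c := count _ (detour d); case: (direct d \in S) => //; lia.
have sS : S \subset edges H.
  apply/subsetP=> f fS; have := allS (origin f); rewrite /tree_traces.
  have ff : f \in fiber S (origin f) by rewrite !inE fS eqxx.
  case: ifP => _; [|case: ifP => _].
  - by rewrite inE => /andP[/subsetP/(_ f ff)]; rewrite inE => /andP[].
  - rewrite inE subsetD1 => /andP[/andP[/subsetP/(_ f ff)]].
    by rewrite inE => /andP[].
  - by rewrite inE => /eqP E; rewrite E inE in ff.
have cE e : e \in edges G -> #|fiber S e| = 4 + (e \in T).
  move=> eG; have := allS e; rewrite /tree_traces eG; case: ifP => _.
    by rewrite inE => /andP[_ /eqP].
  by rewrite inE => /andP[_ /eqP].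
have ET : linked_edges S = T.
  apply/setP=> e; rewrite inE; have [eG|eG] /= := boolP (e \in edges G).
    by rewrite cE //; case: (e \in T).
  by apply/esym/negP=> /(subsetP sT); rewrite (negPf eG).
split=> //; apply/(spanning_treeP S (card_hexagonal_gt0 G0)); split=> //; last first.
  by rewrite card_split // (eq_bigr _ cE) sum_tree_fibers // card_hexagonal -cT addnC addSn.
apply: (lift_connected sT conT) => d; last first.
  by rewrite -card_fiber // -ET inE => /andP[].
have dG : dart_edge d \in edges G by apply/dart_edgeP; exists d.
have := cE _ dG; rewrite card_fiber // count_gadget.
set c := count _ (detour d).
have [dT|dT] := boolP (dart_edge d \in T).
  by case: (direct d \in S); lia.
have := allS (dart_edge d); rewrite /tree_traces (negPf dT) dG inE subsetD1.
rewrite direct_imset in_fiber // mem_head andbT.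
by case/andP=> /andP[_ /negPf->] _; lia.
Qed.

(** Sort the spanning trees by the tree of their linked edges, and count each class
by its traces. *)
Lemma tau_hexagonal : 0 < #|G| ->
  tau H = 5 ^ (#|edges G|.+1 - #|G|) * 6 ^ #|G|.-1 * tau G.
Proof.
move=> G0; rewrite /tau -sum1_card.
pose trees := [set T : {set {set G}} | `[< spanning_tree T >]].
rewrite (partition_big linked_edges (mem trees)) /=; last first.
  by move=> S; rewrite !inE => /asboolP /(tree_linked G0)[? _]; apply/asboolP.
rewrite mulnC -sum_nat_const; apply: eq_bigr => T; rewrite inE => /asboolP treeT.
have [sT conT cT] := (spanning_treeP T G0).1 treeT.
rewrite -cT subSS /= mulnC -card_tree_traces //.
rewrite -(card_fiberwise (h := origin)); last first.
  move=> e A; rewrite /tree_traces; case: ifP => _; [|case: ifP => _].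
  - by rewrite inE => /andP[/subset_trans + _]; apply; apply: subsetIr.
  - rewrite inE subsetD1 => /andP[/andP[/subset_trans + _] _]; apply.
    exact: subsetIr.
  - by rewrite inE => /eqP->; apply: sub0set.
rewrite -sum1_card; apply: eq_bigl => S; rewrite !inE.
apply/andP/forallP => [[/asboolP treeS /eqP ET]|allS].
  by apply/(tree_tracesP S G0 treeT).
have [treeS ->] := (tree_tracesP S G0 treeT).2 allS.
by split=> //; apply/asboolP.
Qed.

End Gadgets.

(** * Iteration and exponents *)

Lemma card_hexagonal_iter_edges (G : sgraph) n :
  #|edges (hexagonal_iter n G)| = 6 ^ n * #|edges G|.
Proof.
elim: n => [|n IHn]; first by rewrite expn0 mul1n.
by rewrite [hexagonal_iter _ _]iterS card_hexagonal_edges IHn expnS mulnA.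
Qed.

Lemma card_hexagonal_iter (G : sgraph) n :
  5 * #|hexagonal_iter n G| + 4 * #|edges G| = 5 * #|G| + 4 * 6 ^ n * #|edges G|.
Proof.
elim: n => [|n IHn]; first by rewrite expn0 muln1.
rewrite [hexagonal_iter _ _]iterS -/(hexagonal_iter n G) card_hexagonal.
rewrite card_hexagonal_iter_edges expnS; move: IHn; rewrite -!mulnA.
by set x := 6 ^ n * _; lia.
Qed.

Import GRing.Theory Num.Theory.
Local Open Scope ring_scope.

(** The connectedness of [G] enters through [#|G| <= #|edges G|.+1], which is
inherited by the iterates and makes the truncated subtraction in [tau_hexagonal]
a true one. *)
Lemma tau_hexagonal_iterS (R : realType) (G : sgraph) (n : nat) :
  connected_graph G -> (0 < #|G|)%N ->
  (tau (hexagonal_iter n.+1 G))%:R =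
    (5 : R) `^ ((1 / 5 * 6 ^+ n + 4 / 5) * #|edges G|%:R - #|G|%:R + 1) *
    (6 : R) `^ (#|G|%:R + 4 / 5 * (6 ^+ n - 1) * #|edges G|%:R - 1) *
    (tau (hexagonal_iter n G))%:R.
Proof.
move=> conG G0.
have cycG : (#|G| <= #|edges G|.+1)%N.
  apply: connected_card => x y; apply: (connect_homo (f := id)) (conG x y) => u v uv.
  by apply: connect1; rewrite /joins /= edges_set2.
have cardE := card_hexagonal_iter_edges G n.
have cardV := card_hexagonal_iter G n.
set K := hexagonal_iter n G in cardE cardV *.
have pow1 : (1 <= 6 ^ n)%N by rewrite expn_gt0.
have [cycK K0] : (#|K| <= #|edges K|.+1)%N /\ (0 < #|K|)%N by split; nia.
have cardVR : 5 * #|K|%:R + 4 * #|edges G|%:R =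
    5 * #|G|%:R + 4 * 6 ^+ n * #|edges G|%:R :> R.
  by have := congr1 (fun k => k%:R : R) cardV; rewrite !(natrD, natrM, natrX).
rewrite [hexagonal_iter _ _]iterS -/(hexagonal_iter n G) -/K tau_hexagonal //.
rewrite !natrM !natrX -(@powR_mulrn _ 5) // -(@powR_mulrn _ 6 #|K|.-1) // natrB //.
rewrite -[#|edges K|.+1]addn1 natrD cardE natrM natrX.
have -> : #|K|.-1%:R = #|K|%:R - 1 :> R by rewrite -subn1 natrB.
congr (_ `^ _ * _ `^ _ * _); lra.
Qed.

Lemma tau_hexagonal_iter (R : realType) (G : sgraph) (n : nat) :
  connected_graph G -> (0 < #|G|)%N ->
  (tau (hexagonal_iter n G))%:R =
    (5 : R) `^ (n%:R * (4 / 5 * #|edges G|%:R - #|G|%:R + 1)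
                + 1 / 25 * (6 ^+ n - 1) * #|edges G|%:R) *
    (6 : R) `^ (n%:R * (#|G|%:R - 4 / 5 * #|edges G|%:R - 1)
                + 4 / 25 * (6 ^+ n - 1) * #|edges G|%:R) *
    (tau G)%:R.
Proof.
move=> conG G0; elim: n => [|n IHn].
  by rewrite expr0 subrr !mulr0 !mul0r addr0 !powRr0 !mul1r.
have powD (a x y : R) : a != 0 -> a `^ x * a `^ y = a `^ (x + y).
  by move=> a0; rewrite powRD // a0 implybT.
rewrite tau_hexagonal_iterS // IHn !mulrA; congr (_ * _).
rewrite -!mulrA [X in _ * X]mulrCA !mulrA powD ?pnatr_eq0 // -mulrA powD ?pnatr_eq0 //.
rewrite exprS -[n.+1]addn1 natrD; congr (_ `^ _ * _ `^ _); lra.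
Qed.

Theorem theorem3p3 (R : realType) (G : sgraph) (N0 E0 n : nat)
    (hconn : connected_graph G) (hN0 : #|G| = N0) (hE0 : #|edges G| = E0)
    (E0_ge1 : (1 <= E0)%N) (n_ge1 : (1 <= n)%N) :
  (tau (hexagonal_iter n G))%:R =
    (5 : R) `^ ((1 / 5 * 6 ^+ n.-1 + 4 / 5) * E0%:R - N0%:R + 1) *
    (6 : R) `^ (N0%:R + 4 / 5 * (6 ^+ n.-1 - 1) * E0%:R - 1) *
    (tau (hexagonal_iter n.-1 G))%:R
  /\
  (tau (hexagonal_iter n G))%:R =
    (5 : R) `^ (n%:R * (4 / 5 * E0%:R - N0%:R + 1)
                + 1 / 25 * (6 ^+ n - 1) * E0%:R) *
    (6 : R) `^ (n%:R * (N0%:R - 4 / 5 * E0%:R - 1)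
                + 4 / 25 * (6 ^+ n - 1) * E0%:R) *
    (tau G)%:R.
Proof.
have G0 : (0 < #|G|)%N.
  move: E0_ge1; rewrite -hE0 => /card_gt0P[e /edgesP[x _]].
  by apply/card_gt0P; exists x.
rewrite -hN0 -hE0; split; last exact: tau_hexagonal_iter.
by case: n n_ge1 => // n _; apply: tau_hexagonal_iterS.
Qed.
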